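(* Let $\Delta > 0$ and $p > 0$, let $\{I_k\}_{k\ge 1}$ be the sequence of change indicators of a page with change rate $\Delta$ and crawling rate $p$ (as defined in the context), and let $\hat I_k = \sum_{j=1}^k I_j$. Let $\{\alpha_k\}_{k \ge 1}$ be a (deterministic) sequence of positive real numbers, and define the LLN estimator, for $k \geq 1$, by $$x_k = \frac{p\, \hat I_k}{k + \alpha_k - \hat I_k}.$$ 1. If $\lim_{k \to \infty} \alpha_k/k = 0$, then $\lim_{k\to\infty} x_k = \Delta$ almost surely. 2. If $\lim_{k \to \infty} \alpha_k/k = 0$ and, additionally, $\lim_{k\to\infty} \log(k/\alpha_k)/k = 0$, then, as $k \to \infty$, $$\mathbb{E}|x_k - \Delta| = O\left(\max\left\{k^{-1/2},\ \alpha_k/k\right\}\right).$$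
   Context: Setup: a single page changes at the points of a homogeneous Poisson point process on $[0,\infty)$ with constant rate $\Delta$. Independently of this process, the page is crawled at random times $0 = t_0 < t_1 < t_2 < \cdots$, where the inter-arrival times $\{t_k - t_{k-1}\}_{k \ge 1}$ are iid exponential random variables with rate $p$. For $k \ge 1$, the change indicator is $I_k = 1$ if the page changed at least once in $(t_{k-1}, t_k]$ (i.e., the change process has at least one point in this interval), and $I_k = 0$ otherwise. The implied constant in $O(\cdot)$ does not depend on $k$ (it may depend on $\Delta$, $p$ and the sequence $\{\alpha_k\}$). *)

(* Defs.v *)
From HB Require Import structures.
From mathcomp Require Import all_boot all_order all_algebra.
From mathcomp Require Import all_classical all_reals all_analysis.
From mathcomp Require Import measurable_realfun.
Set Implicit Arguments.
Unset Strict Implicit.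
Unset Printing Implicit Defensive.
Import Order.TTheory GRing.Theory Num.Theory.
Import numFieldNormedType.Exports.

Local Open Scope classical_set_scope.
Local Open Scope ring_scope.

Definition mutually_independent {d d'} {T : measurableType d}
    {E : measurableType d'} {R : realType} (P : probability T R)
    (I : eqType) (X : I -> T -> E) : Prop :=
  forall (J : seq I) (B : I -> set E), uniq J ->
    (forall i, measurable (B i)) ->
    P [set w | forall i, i \in J -> B i (X i w)] =
    (\prod_(i <- J) P (X i @^-1` B i))%E.

Definition sigma_generated {d'} {T : Type} {E : measurableType d'} (I : Type)
    (X : I -> T -> E) : set_system T :=
  <<s [set A | exists i, exists2 B, measurable B & A = X i @^-1` B] >>.

Definition independent_systems {d} {T : measurableType d} {R : realType}
    (P : probability T R) (F G : set_system T) : Prop :=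
  forall A B, F A -> G B -> P (A `&` B) = (P A * P B)%E.

Definition npoints {T : Type} {R : realType} (Phi : T -> set R) (A : set R)
  (w : T) : \bar R := counting (Phi w `&` A).

(* A point process is given by its random set [Phi w] of points; it is simple,
   as is (a.s.) any Poisson process with diffuse intensity. *)
Record poisson_process {d} {T : measurableType d} {R : realType}
    (P : probability T R) (Delta : R) (Phi : T -> set R) : Prop := {
  poisson_support : forall w, Phi w `<=` `[0, +oo[ ;
  poisson_locally_finite : forall w b, finite_set (Phi w `&` `[0, b]) ;
  poisson_measurable : forall A : set R, measurable A ->
    measurable_fun setT (npoints Phi A) ;
  (* the second explicit argument of [poisson_prob] is idle; unlike
     [poisson_pmf], [poisson_prob] is the Dirac mass at 0 when the rate is 0 *)
  poisson_law : forall A : set R, measurable A -> A `<=` `[0, +oo[ ->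
    (lebesgue_measure A < +oo)%E -> forall n : nat,
    P [set w | npoints Phi A w = n%:R%:E] =
    poisson_prob (Delta * fine (lebesgue_measure A)) 0 [set n] ;
  poisson_independent : forall A : nat -> set R,
    (forall i, measurable (A i)) -> (forall i, A i `<=` `[0, +oo[) ->
    trivIset setT A -> mutually_independent P (fun i => npoints Phi (A i)) }.

(* The law of the gaps is only compared on measurable sets, the values of a
   measure elsewhere being irrelevant. *)
Record crawl_times {d} {T : measurableType d} {R : realType}
    (P : probability T R) (p : R) (t : nat -> {RV P >-> R}) : Prop := {
  crawl_start : forall w, t 0%N w = 0 ;
  crawl_increasing : {ae P, forall w, forall k, t k w < t k.+1 w} ;
  crawl_gap_law : forall k (A : set R), measurable A ->
    distribution P (t k.+1 \- t k) A = exponential_prob p A ;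
  crawl_gap_independent :
    mutually_independent P (fun k w => t k.+1 w - t k w) }.

Record crawled_page {d} {T : measurableType d} {R : realType}
    (P : probability T R) (Delta p : R) (Phi : T -> set R)
    (t : nat -> {RV P >-> R}) : Prop := {
  page_changes : poisson_process P Delta Phi ;
  page_crawls : crawl_times p t ;
  page_independent : independent_systems P
    (sigma_generated (fun A : {A : set R | measurable A} =>
       npoints Phi (sval A)))
    (sigma_generated (fun k => t k : T -> R)) }.

Section estimator.
Context {d} {T : measurableType d} {R : realType} {P : probability T R}.
Variables (Phi : T -> set R) (t : nat -> {RV P >-> R}).

(* meaningful for [0 < k] only *)
Definition change_indicator (k : nat) : T -> R :=
  \1_[set w | Phi w `&` `]t k.-1 w, t k w] !=set0].

Definition change_count (k : nat) (w : T) : R :=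
  \sum_(1 <= j < k.+1) change_indicator j w.

Definition lln_estimator (p : R) (alpha : nat -> R) (k : nat) (w : T) : R :=
  p * change_count k w / (k%:R + alpha k - change_count k w).

End estimator.

(* Main.v *)
Require Import Defs.
From HB Require Import structures.
From mathcomp Require Import all_boot all_order all_algebra.
From mathcomp Require Import all_classical all_reals all_analysis.
From mathcomp Require Import finmap measurable_realfun ring lra.
Import Order.TTheory GRing.Theory Num.Theory.
Import numFieldNormedType.Exports.
Set Implicit Arguments.
Unset Strict Implicit.
Unset Printing Implicit Defensive.
Local Open Scope classical_set_scope.
Local Open Scope ring_scope.

(** Write [q = Delta / (Delta + p)] and [S k] for the number of changes seen in
    the first [k] crawls.  The joint law of the indicators is obtained from the
    void probabilities: rounding the crawl gaps up to multiples of [1/N] makes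
    the crawl times take countably many values, so that independence of the two
    processes gives the probability of seeing no change in the gaps of [J] as a
    finite product of sums, and [N -> oo] yields [(1 - q)^|J|].  Expanding
    [\prod_i (a + b (1 - I_i))] over subsets then computes the exponential
    moments of [S k - q k], and they are at most [expR (2 c^2 k)] for
    [|c| <= 1/2].  Part 1 follows by Chernoff bounds and Borel-Cantelli.  For
    part 2,
      [x_k - Delta = (Delta + p) (S k - q k - q alpha_k) / (k + alpha_k - S k)];
    the denominator is of order [k] unless [S k - q k] is at least a constant
    times [k], an event of exponentially small probability on which the error
    is only [O(1 + k / alpha_k)], that is, subexponential. *)

(** * Exponential inequalities and elementary laws *)

(** From [expR (- u) >= 1 - u] one gets [expR u * (1 - u) <= 1], while the claimed bound times
    [1 - u] equals [1 + u^2 (1 - 2u) >= 1]. *)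
Lemma expR_le_quadratic (R : realType) (u : R) :
  u <= 2^-1 -> expR u <= 1 + u + 2 * u ^+ 2.
Proof.
move=> u2.
have v0 : 0 < 1 - u by lra.
have h : expR u * (1 - u) <= 1.
  have := ler_wpM2l (expR_ge0 u) (expR_ge1Dx (- u)).
  by rewrite expRN mulfV ?gt_eqF ?expR_gt0.
rewrite -(ler_pM2r v0) (le_trans h)//.
rewrite [leRHS](_ : _ = 1 + u ^+ 2 * (1 - 2 * u)); last by ring.
by rewrite lerDl mulr_ge0 ?sqr_ge0//; lra.
Qed.

(** The left side is the moment generating function of a centred Bernoulli variable: the first-order
    terms cancel and the quadratic ones leave [2 c^2 q (1 - q)]. *)
Lemma bernoulli_mgf_le (R : realType) (q c : R) :
  0 <= q <= 1 -> `|c| <= 2^-1 ->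
  q * expR (c * (1 - q)) + (1 - q) * expR (- (c * q)) <= expR (2 * c ^+ 2).
Proof.
move=> /andP[q0 q1]; rewrite ler_norml => /andP[c1 c2].
have h1 : c * (1 - q) <= 2^-1 by nra.
have h2 : - (c * q) <= 2^-1 by nra.
apply: (@le_trans _ _ (1 + 2 * c ^+ 2)); last exact: expR_ge1Dx.
have H1 := ler_wpM2l q0 (expR_le_quadratic h1).
have q1' : 0 <= 1 - q by lra.
have H2 := ler_wpM2l q1' (expR_le_quadratic h2).
apply: (le_trans (lerD H1 H2)).
rewrite [leLHS](_ : _ = 1 + 2 * c ^+ 2 * (q * (1 - q))); last by ring.
have q2 : 0 <= q * q by rewrite mulr_ge0.
rewrite lerD2l ler_piMr//; first by rewrite mulr_ge0// sqr_ge0.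
by rewrite mulrBr mulr1 lerBlDr (le_trans q1)// lerDl.
Qed.

Lemma counting_eq0 (T : choiceType) (R : realType) (X : set T) :
  (counting X = 0 :> \bar R) <-> X = set0.
Proof.
split=> [|->]; last by rewrite /counting asboolT// fset_set0.
rewrite /counting; case: asboolP => // fX /eqP.
rewrite eqe pnatr_eq0 finmap.cardfs_eq0 => /eqP h.
by rewrite -(fset_setK fX) h set_fset0.
Qed.

Lemma poisson_prob_set0 (R : realType) (r : R) : 0 <= r ->
  poisson_prob r 0 [set 0%N] = (expR (- r))%:E.
Proof.
rewrite le_eqVlt /poisson_prob => /predU1P[<-|r0].
  by rewrite ltxx oppr0 expR0 diracE mem_set.
rewrite r0 esum_set1; last by rewrite lee_fin poisson_pmf_ge0.
by rewrite /poisson_pmf r0 expr0 fact0 invr1 !mul1r.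
Qed.

Lemma exponential_prob_itv_co (R : realType) (p a b : R) :
  0 <= a -> a < b ->
  exponential_prob p `[a, b[ = (expR (- p * a) - expR (- p * b))%:E.
Proof.
move=> a0 ab.
have cE : continuous (fun z : R => expR (- p * z)).
  move=> z; apply: continuous_comp; last exact: continuous_expR.
  exact: (@mulrl_continuous R).
have mE : measurable_fun `[a, b[ (EFin \o exponential_pdf p).
  apply/measurable_EFinP/measurable_funTS.
  exact: measurable_exponential_pdf.
rewrite /exponential_prob integral_itv_bndo_bndc//.
rewrite (@continuous_FTC2 _ _ (fun x => - expR (- p * x)))//.
- by rewrite -EFinD opprK addrC.
- apply: (@continuous_subspaceW R^o _ _ [set` `[0, +oo[%R]).
    by apply: subset_itv; rewrite bnd_simp.
  exact: within_continuous_exponential_pdf.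
- split.
  + by move=> z _; exact: ex_derive.
  + by apply/cvg_at_right_filter; apply: cvgN; exact: cE.
  + by apply/cvg_at_left_filter; apply: cvgN; exact: cE.
- move=> z; rewrite in_itv/= => /andP[az _].
  by apply: derive1_exponential_pdf; rewrite in_itv/= andbT (le_lt_trans a0).
Qed.

(** * The Laplace transform of the exponential law as a limit of sums *)

Lemma sum_geometric (R : fieldType) (x : R) (M : nat) : x != 1 ->
  \sum_(m < M) x ^+ m = (1 - x ^+ M) / (1 - x).
Proof.
move=> x1; have x1' : 1 - x != 0 by rewrite subr_eq0 eq_sym.
apply: (mulIf x1'); rewrite divfK// -(opprB x 1) mulrN mulrC -subrX1.
by rewrite opprB.
Qed.

Lemma cvg_divn0 (R : realType) (a : R) : a / n.+1%:R @[n --> \oo] --> 0.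
Proof.
rewrite -(mulr0 a); apply: (@cvgM R); first exact: cvg_cst.
exact: cvg_harmonic.
Qed.

(** Squeeze by [1 - u <= expR (- u) <= 1 / (1 + u)] at [u = a / n.+1]. *)
Lemma cvg_expR_quotient (R : realType) (a : R) : 0 <= a ->
  n.+1%:R * (1 - expR (- (a / n.+1%:R))) @[n --> \oo] --> a.
Proof.
move=> a0; apply: (@squeeze_cvgr _ _ _ _ (fun n => a / (1 + a / n.+1%:R)) (fun=> a)).
- apply: nearW => n; set u := a / n.+1%:R.
  have u0 : 0 <= u by apply: divr_ge0.
  have u1 : 0 < 1 + u by rewrite ltr_pwDl.
  have aE : a = n.+1%:R * u by rewrite mulrC divfK ?pnatr_eq0.
  rewrite {1 2}aE; apply/andP; split; last first.
    by rewrite ler_wpM2l// lerBlDr -lerBlDl expR_ge1Dx.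
  have -> : n.+1%:R * u / (1 + u) = n.+1%:R * (1 - (1 + u)^-1).
    by field; rewrite gt_eqF.
  rewrite ler_wpM2l// lerB// expRN.
  by rewrite lef_pV2 ?posrE ?expR_gt0// expR_ge1Dx.
- rewrite -[X in _ --> X]divr1; apply: (@cvgM R); first exact: cvg_cst.
  apply: cvgV; first exact: oner_neq0.
  rewrite -[X in _ --> X]addr0; apply: (@cvgD _ R); first exact: cvg_cst.
  exact: cvg_divn0.
- exact: cvg_cst.
Qed.

(* The sum is E[exp(-D * ceil(N*G)/N); G < N] with N = n+1 and G exponential of
   rate p, and the limit is E[exp(-D*G)]. *)
Lemma cvg_discretized_laplace (R : realType) (p D : R) : 0 < p -> 0 <= D ->
  \sum_(m < (n.+1 * n.+1)%N)
     (expR (- p * (m%:R / n.+1%:R)) - expR (- p * (m.+1%:R / n.+1%:R))) *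
     expR (- (D * (m.+1%:R / n.+1%:R))) @[n --> \oo] --> p / (p + D).
Proof.
move=> p0 D0; have pD0 : 0 < p + D by rewrite ltr_pwDl.
pose x n : R := expR (- ((p + D) / n.+1%:R)).
(* The sum is geometric with ratio [x n]. Its [n.+1 * n.+1] terms of mesh [1 / n.+1] reach up to
   [n.+1], so the missing tail is of relative size [expR (- ((p + D) * n.+1))], which vanishes. *)
rewrite [X in X @ _ --> _](_ : _ = fun n =>
  (n.+1%:R * (1 - expR (- (p / n.+1%:R)))) * expR (- (D / n.+1%:R)) *
  (1 - expR (- ((p + D) * n.+1%:R))) / (n.+1%:R * (1 - x n))); last first.
  apply/funext => n; set N : R := n.+1%:R.
  have N0 : N != 0 by rewrite pnatr_eq0.
  have x1 : x n != 1.
    by rewrite lt_eqF// -expR0 ltr_expR oppr_lt0 divr_gt0.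
  have x1' : 1 - x n != 0 by rewrite subr_eq0 eq_sym.
  rewrite (eq_bigr (fun m : 'I__ =>
    (1 - expR (- (p / N))) * expR (- (D / N)) * x n ^+ m)); last first.
    move=> m _; rewrite /x -expRM_natl mulrBl -!expRD -/N mulrBl mulrBl mul1r.
    rewrite -!expRD -natr1; clearbody N.
    by congr (expR _ - expR _); field.
  rewrite -mulr_sumr sum_geometric//.
  rewrite (_ : x n ^+ (n.+1 * n.+1) = expR (- ((p + D) * n.+1%:R))); last first.
    by rewrite /x -expRM_natl natrM -/N; clearbody N; congr expR; field.
  by rewrite -/N; clearbody N; field; rewrite N0 x1'.
rewrite [X in _ --> X](_ : _ = p * 1 * (1 - 0) / (p + D)); last first.
  by rewrite subr0 !mulr1.
apply: (@cvgM R); last first.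
  by apply: cvgV; [rewrite gt_eqF | apply: cvg_expR_quotient; exact: ltW].
apply: (@cvgM R).
  apply: (@cvgM R); first by apply: cvg_expR_quotient; exact: ltW.
  rewrite -[X in _ --> X](@expR0 R).
  apply: (@cvg_comp _ _ _ _ expR _ (nbhs (0 : R))); last exact: continuous_expR.
  suff h : - (D / n.+1%:R) @[n --> \oo] --> 0 by exact: h.
  by rewrite -[X in _ --> X]oppr0; apply: cvgN; exact: cvg_divn0.
apply: cvgB; first exact: cvg_cst.
apply: (@squeeze_cvgr _ _ _ _ (fun=> 0) (fun n => (p + D)^-1 / n.+1%:R)).
- apply: nearW => n; rewrite expR_ge0/= expRN -invfM.
  rewrite lef_pV2 ?posrE ?expR_gt0 ?mulr_gt0//.
  by rewrite (le_trans _ (expR_ge1Dx _))// lerDr.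
- exact: cvg_cst.
- exact: cvg_divn0.
Qed.

(** * Void events *)

(** Only finitely many points of [F] lie in [[0, a + 1]], so those beyond [a] stay at a positive
    distance from it. The shift goes to the right only: a shift to the left could pass a point
    located at [a]. *)
Lemma near_locally_finite_gap (R : realType) (F : set R) (a : R) :
  F `<=` `[0, +oo[ -> (forall b, finite_set (F `&` `[0, b])) ->
  \forall d \near 0^'+, forall x y, F x -> a <= y <= a + d ->
    (a < x) = (y < x).
Proof.
move=> F0 fF.
pose G := fset_set (F `&` `[0, a + 1]).
have h : \forall d \near 0^'+, forall x, (x \in G) -> a < x -> a + d < x.
  pose f x := [set d | a < x -> a + d < x].
  have hf : \forall d \near 0^'+, (\bigcap_(i in [set` G]) f i) d.
    apply: filter_bigI => x _.
    have [ax|ax] := ltP a x; last first.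
      by apply: nearW => d _ ax'; have := le_lt_trans ax ax'; rewrite ltxx.
    near=> d => _; rewrite -ltrBrDl; near: d; apply: nbhs_right_lt.
    by rewrite subr_gt0.
  by apply: filterS hf => d hd x xG; exact: hd.
near=> d => x y Fx /andP[ay yd]; apply/idP/idP; last exact: le_lt_trans.
move=> ax; apply: le_lt_trans yd _.
have [xa|xa] := leP x (a + 1).
  have xG : x \in G.
    rewrite in_fset_set//; apply/mem_set; split=> //.
    by have := F0 _ Fx; rewrite /= !in_itv/= andbT => ->.
  by move: x xG ax {Fx xa}; near: d.
apply: le_lt_trans xa; rewrite lerD2l; near: d.
exact: nbhs_right_ltW.
Unshelve. all: by end_near. Qed.

Lemma locally_finite_perturb (R : realType) (F : set R) (s : nat -> R)
    (k : nat) :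
  F `<=` `[0, +oo[ -> (forall b, finite_set (F `&` `[0, b])) ->
  exists2 d, 0 < d & forall j y x, (j <= k)%N -> s j <= y <= s j + d ->
    F x -> (s j < x) = (y < x).
Proof.
move=> F0 fF.
have : \forall d \near 0^'+, 0 < d /\ forall (j : 'I_k.+1) x y, F x ->
    s j <= y <= s j + d -> (s j < x) = (y < x).
  near=> d; split; first by near: d; exact: nbhs_right_gt.
  near: d; apply: filter_forall => j; exact: near_locally_finite_gap.
move=> /filter_ex[d [d0 hd]]; exists d => // j y x jk sy Fx.
by have := hd (Ordinal (jk : (j < k.+1)%N)) x y Fx sy.
Unshelve. all: by end_near. Qed.

Lemma npoints_eq0 (T : Type) (R : realType) (Phi : T -> set R) (A : set R) w :
  npoints Phi A w = 0%E <-> Phi w `&` A = set0.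
Proof. exact: counting_eq0. Qed.

Section random_interval.
Context {d} {T : measurableType d} {R : realType} {P : probability T R}.
Variables (Delta : R) (Phi : T -> set R).
Hypothesis Poi : poisson_process P Delta Phi.

Lemma measurable_npoints_eq0 (A : set R) : measurable A ->
  measurable [set w | Phi w `&` A = set0].
Proof.
move=> mA; rewrite [X in measurable X](_ : _ =
  setT `&` npoints Phi A @^-1` [set 0%E]).
  exact: (poisson_measurable Poi mA).
by rewrite setTI; apply/seteqP; split => w /npoints_eq0.
Qed.

(* With r and s rational, Phi meets ]u, v] iff for some r > u it meets ]r, s]
   for all s > v. *)
Lemma measurable_meets_random_interval (u v : T -> R) :
  measurable_fun setT u -> measurable_fun setT v ->
  measurable [set w | Phi w `&` `]u w, v w] !=set0].
Proof.
move=> mu mv.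
pose E (r s : rat) := [set w | ratr s <= v w] `|`
   ~` [set w | Phi w `&` `]ratr r, ratr s] = set0].
rewrite [X in measurable X](_ : _ = \bigcup_(r : rat)
  ([set w | u w < ratr r] `&` \bigcap_(s : rat) E r s)).
  apply: bigcupT_measurable_rat => r; apply: measurableI.
    rewrite -[X in measurable X]setTI.
    exact: measurable_fun_ltr.
  rewrite -[X in measurable X]setCK setC_bigcap; apply: measurableC.
  apply: bigcupT_measurable_rat => s; apply: measurableC; apply: measurableU.
    rewrite -[X in measurable X]setTI.
    exact: measurable_fun_ler.
  by apply: measurableC; exact: measurable_npoints_eq0.
apply/seteqP; split=> w /=.
  move=> [x [Phix]]; rewrite /= in_itv/= => /andP[ux xv].
  have [r] := rat_in_itvoo ux; rewrite in_itv/= => /andP[ur rx].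
  exists r => //; split=> // s _; rewrite /E /=.
  have [sv|vs] := leP (ratr s) (v w); [by left|right].
  apply/eqP/set0P; exists x; split=> //=.
  by rewrite in_itv/= rx (le_trans xv)// ltW.
move=> [r _ [ur hE]].
(* For a rational [s] slightly above [v w], no point of [Phi w] lies in []v w, s]]; the point found
   in []r, s]] is thus at most [v w]. *)
have [e e0 he] := @locally_finite_perturb R (Phi w) (fun=> v w) 0
  (@poisson_support _ _ _ _ _ _ Poi w) (poisson_locally_finite Poi w).
have [s] : exists q : rat, ratr q \in `]v w, v w + e[.
  by apply: rat_in_itvoo; rewrite ltrDl.
rewrite in_itv/= => /andP[vs se].
have [|/eqP/set0P[x [Phix]]] := hE s I; first by rewrite /= leNgt vs.
rewrite /= in_itv/= => /andP[rx xs].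
exists x; split=> //=; rewrite in_itv/= (lt_trans ur rx)/=.
by rewrite leNgt (he 0%N (ratr s) x)// ?(ltW vs) ?(ltW se)// -leNgt.
Qed.

End random_interval.

(** Dominated convergence for indicators, with dominating function 1. *)
Lemma cvg_measure_eventually_eq {d} {T : measurableType d} {R : realType}
    (P : probability T R) (E_ : nat -> set T) (E : set T) :
  (forall n, measurable (E_ n)) -> measurable E ->
  {ae P, forall w, \forall n \near \oo, E_ n w <-> E w} ->
  P (E_ n) @[n --> \oo] --> P E.
Proof.
move=> mE_ mE aeE.
have [|||||_ _] := @dominated_convergence _ _ _ P setT measurableT
  (fun n w => (\1_(E_ n) w)%:E) (fun w => (\1_E w)%:E) (cst 1%E).
- by move=> n; apply/measurable_EFinP; exact: measurable_indic.
- by apply/measurable_EFinP; exact: measurable_indic.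
- apply: filterS aeE => w hw _; apply: cvg_near_cst.
  apply: filterS hw => n hn; congr (_%:E); rewrite !indicE.
  rewrite (_ : (w \in E_ n) = (w \in E))//.
  by apply/idP/idP => /set_mem/hn/mem_set.
- exact: finite_measure_integrable_cst.
- apply: nearW => w n _; rewrite abse_EFin lee_fin indicE ger0_norm//.
  by rewrite lern1 leq_b1.
by under eq_fun do rewrite integral_indic// setIT; rewrite integral_indic// setIT.
Qed.

Lemma trivIset_consecutive_itv (R : realType) (s : nat -> R) :
  {homo s : i j / (i <= j)%N >-> i <= j} ->
  trivIset setT (fun j => `]s j, s j.+1]%classic).
Proof.
move=> s_nd.
suff H i j x : (i < j)%N -> s i < x -> x <= s i.+1 -> s j < x -> False.
  move=> i j _ _ [x [/=]]; rewrite !in_itv/= => /andP[i1 i2] /andP[j1 j2].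
  by have [/H|/H|//] := ltngtP i j; move=> /(_ x); case.
move=> ij _ xi jx; have := lt_le_trans jx xi.
by rewrite ltNge s_nd.
Qed.

Section poisson_void.
Context {d} {T : measurableType d} {R : realType} {P : probability T R}.
Variables (Delta : R) (Phi : T -> set R).
Hypotheses (Delta0 : 0 <= Delta) (Poi : poisson_process P Delta Phi).

Lemma poisson_void (s : nat -> R) (J : seq nat) :
  {homo s : i j / (i <= j)%N >-> i <= j} -> 0 <= s 0%N -> uniq J ->
  P [set w | forall j, j \in J -> Phi w `&` `]s j, s j.+1] = set0] =
  (\prod_(j <- J) expR (- (Delta * (s j.+1 - s j))))%:E.
Proof.
move=> s_nd s0 uJ; pose A j : set R := `]s j, s j.+1]%classic.
have A0 j : A j `<=` `[0, +oo[.
  move=> x; rewrite /A/= !in_itv/= andbT => /andP[/ltW + _].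
  by apply: le_trans; rewrite (le_trans s0)// s_nd.
have mA j : measurable (A j) by exact: measurable_itv.
have := @poisson_independent _ _ _ _ _ _ Poi A mA A0
  (trivIset_consecutive_itv s_nd) J (fun=> [set 0%E]) uJ.
rewrite [X in P X](_ : _ =
    [set w | forall j, j \in J -> Phi w `&` `]s j, s j.+1] = set0]); last first.
  by apply/seteqP; split => w h j jJ; apply/npoints_eq0; exact: h.
move=> ->//; rewrite -prodEFin; apply: eq_bigr => j _.
rewrite -[X in P X]/([set w | npoints Phi (A j) w = 0%:R%:E]).
have lA : lebesgue_measure (A j) = (s j.+1 - s j)%:E.
  (* The formula for the measure has a separate case for empty intervals; monotonicity then forces
     equal endpoints, so the length is 0 there too. *)
  rewrite lebesgue_measure_itv/= lte_fin; case: ifPn => //.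
  rewrite -leNgt => h; rewrite (_ : s j.+1 = s j) ?subrr//.
  by apply/eqP; rewrite eq_le h s_nd.
rewrite (poisson_law Poi)//; last by rewrite lA ltry.
by rewrite lA/= poisson_prob_set0// mulr_ge0// subr_ge0 s_nd.
Qed.

End poisson_void.

(** * Discretized crawl times *)

Lemma measurable_forall_lt {d} {T : measurableType d} (k : nat) (J : pred nat)
    (C : nat -> set T) : (forall j, measurable (C j)) ->
  measurable [set w | forall j, (j < k)%N -> J j -> C j w].
Proof.
move=> mC; rewrite [X in measurable X](_ : _ =
  \bigcap_(j in [set j | (j < k)%N /\ J j]) C j).
  by apply: bigcap_measurableType => j _; exact: mC.
by apply/seteqP; split => w h j; [case; exact: h | move=> jk Jj; exact: h].
Qed.

Lemma near_gtnS (R : realType) (r : R) : \forall n \near \oo, r < n.+1%:R.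
Proof.
near=> n; rewrite (@lt_trans _ _ n%:R)// ?ltr_nat//; near: n.
exact: nbhs_infty_gtr.
Unshelve. all: by end_near. Qed.

Section void_crawl_gaps.
Context {d} {T : measurableType d} {R : realType} {P : probability T R}.
Variables (Delta p : R) (Phi : T -> set R) (t : nat -> {RV P >-> R}).
Hypotheses (Delta_gt0 : 0 < Delta) (p_gt0 : 0 < p).
Hypothesis page : crawled_page Delta p Phi t.
Variables (k : nat) (J : pred nat).

Let Poi : poisson_process P Delta Phi := page_changes page.
Let crawl : crawl_times p t := page_crawls page.

(** The times may depend on the outcome, so that the crawl times and the deterministic grid times
    share one definition. *)
Definition void_event (s : nat -> T -> R) : set T :=
  [set w | forall j, (j < k)%N -> J j ->
     Phi w `&` `]s j w, s j.+1 w] = set0].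

Lemma measurable_void_event (s : nat -> T -> R) :
  (forall j, measurable_fun setT (s j)) -> measurable (void_event s).
Proof.
move=> ms; apply: measurable_forall_lt => j.
rewrite [X in measurable X](_ : _ =
    ~` [set w | Phi w `&` `]s j w, s j.+1 w] !=set0]).
  by apply: measurableC; exact: (measurable_meets_random_interval Poi).
by apply/seteqP; split => w /=; [move=> ->; case | move/nonemptyPn].
Qed.

Section cells.
Variable N : nat.
Implicit Type m : nat -> nat.

Definition gap_cell m : set T := [set w | forall i, (i < k)%N -> true ->
  (m i)%:R / N.+1%:R <= t i.+1 w - t i w < (m i).+1%:R / N.+1%:R].

(** On the cell of [m], this is the crawl time with each gap replaced by the right end of its mesh
    interval. Rounding up keeps it at or after the true time, as the rightward perturbation lemma
    requires. *)
Definition grid_time m (j : nat) : R := \sum_(i < j) (m i).+1%:R / N.+1%:R.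

Lemma grid_timeS m j : grid_time m j.+1 = grid_time m j + (m j).+1%:R / N.+1%:R.
Proof. by rewrite /grid_time big_ord_recr. Qed.

Lemma grid_time_nd m : {homo grid_time m : i j / (i <= j)%N >-> i <= j}.
Proof.
apply: (@homo_leq _ _ (fun x y => x <= y)) => //; first exact: le_trans.
by move=> j; rewrite grid_timeS lerDl divr_ge0.
Qed.

(** Each gap is rounded up by at most one mesh width, and the errors add up. *)
Lemma gap_cell_grid_time m w j : gap_cell m w -> (j <= k)%N ->
  t j w <= grid_time m j <= t j w + j%:R / N.+1%:R.
Proof.
move=> mw; elim: j => [_|j ih jk].
  by rewrite /grid_time big_ord0 (crawl_start crawl) mul0r addr0 lexx.
have /andP[h1 h2] := ih (ltnW jk); have /andP[h3 h4] := mw j jk isT.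
have e1 i : i.+1%:R / N.+1%:R = i%:R / N.+1%:R + N.+1%:R^-1 :> R.
  by rewrite -[i.+1%:R]natr1 mulrDl mul1r.
rewrite grid_timeS; move: h4; rewrite !e1 => h4.
move: h1 h2 h3 h4; move: (N.+1%:R^-1) => c; move: ((m j)%:R * c) (j%:R * c) => a b.
move: (t j w) (t j.+1 w) (grid_time m j) => u v g *.
by apply/andP; split; lra.
Qed.

Lemma probability_gap_cell m :
  P (gap_cell m) = (\prod_(i < k)
    (expR (- p * ((m i)%:R / N.+1%:R)) - expR (- p * ((m i).+1%:R / N.+1%:R))))%:E.
Proof.
pose B (i : nat) : set R := `[(m i)%:R / N.+1%:R, (m i).+1%:R / N.+1%:R[%classic.
have mB i : measurable (B i) by exact: measurable_itv.
have := @crawl_gap_independent _ _ _ _ _ _ crawl (iota 0 k) B (iota_uniq _ _) mB.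
rewrite [X in P X](_ : _ = gap_cell m); last first.
  apply/seteqP; split => w h i.
    move=> ik _; have := h i; rewrite mem_iota add0n => /(_ ik).
    by rewrite /B/= in_itv.
  by rewrite mem_iota add0n => ik; rewrite /B/= in_itv/=; exact: h.
move=> ->; rewrite -prodEFin -{1}(subn0 k) -/(index_iota 0 k) big_mkord.
apply: eq_bigr => i _.
rewrite -exponential_prob_itv_co ?divr_ge0//; last first.
  by rewrite ltr_pM2r ?invr_gt0// ltr_nat.
exact: (@crawl_gap_law _ _ _ _ _ _ crawl i (B i) (mB i)).
Qed.

Lemma probability_void_grid_time m :
  P (void_event (fun j _ => grid_time m j)) =
  (\prod_(j < k | J j) expR (- (Delta * ((m j).+1%:R / N.+1%:R))))%:E.
Proof.
have := poisson_void (ltW Delta_gt0) Poi (@grid_time_nd m) _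
  (filter_uniq J (iota_uniq 0 k)).
rewrite [X in P X](_ : _ = void_event (fun j _ => grid_time m j)); last first.
  apply/seteqP; split => w h j.
    by move=> jk Jj; apply: h; rewrite mem_filter Jj mem_iota.
  by rewrite mem_filter mem_iota add0n => /andP[Jj jk]; exact: h.
move=> ->; last by rewrite /grid_time big_ord0.
congr (_%:E); rewrite big_filter -{1}(subn0 k) -/(index_iota 0 k) big_mkord.
by apply: eq_bigr => j _; rewrite grid_timeS addrAC subrr add0r.
Qed.

(** Independence of page and crawler applies to events of the generated sigma-algebras, so
    measurability is proved anew with [T] carrying the sigma-algebra generated by the crawl
    times. *)
Lemma sigma_generated_gap_cell m :
  sigma_generated (fun i => t i : T -> R) (gap_cell m).
Proof.
pose G := [set A : set T | exists i : nat, exists2 B : set R,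
  measurable B & A = (t i : T -> R) @^-1` B].
have mt i : measurable_fun setT (t i : g_sigma_algebraType G -> R).
  move=> _ B mB; rewrite setTI; apply: sub_sigma_algebra.
  by exists i, B.
suff : measurable (gap_cell m : set (g_sigma_algebraType G)) by [].
apply: measurable_forall_lt => i.
have mg : measurable_fun setT (fun w : g_sigma_algebraType G => t i.+1 w - t i w).
  exact: measurable_funB.
have := mg measurableT `[(m i)%:R / N.+1%:R, (m i).+1%:R / N.+1%:R[%classic.
rewrite setTI => /(_ (measurable_itv _)).
by congr measurable; apply/seteqP; split => w /=; rewrite in_itv.
Qed.

Lemma sigma_generated_void_grid_time m :
  sigma_generated (fun A : {A : set R | measurable A} => npoints Phi (sval A))
    (void_event (fun j _ => grid_time m j)).
Proof.
pose G := [set A : set T | exists i : {A : set R | measurable A},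
  exists2 B : set (\bar R), measurable B & A = npoints Phi (sval i) @^-1` B].
suff : measurable (void_event (fun j _ => grid_time m j)
  : set (g_sigma_algebraType G)) by [].
apply: measurable_forall_lt => j; apply: sub_sigma_algebra.
have mI : measurable `]grid_time m j, grid_time m j.+1]%classic.
  exact: measurable_itv.
exists (exist _ _ mI), [set 0%E] => //.
by apply/seteqP; split => w /npoints_eq0.
Qed.

Lemma measurable_gap_cell m : measurable (gap_cell m).
Proof.
apply: measurable_forall_lt => i.
have mg : measurable_fun setT (fun w => t i.+1 w - t i w).
  exact: measurable_funB.
have := mg measurableT `[(m i)%:R / N.+1%:R, (m i).+1%:R / N.+1%:R[%classic.
rewrite setTI => /(_ (measurable_itv _)).
by congr measurable; apply/seteqP; split => w /=; rewrite in_itv.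
Qed.

End cells.

(* [grid_index m] extends m by 0 outside 'I_k. *)
Definition grid_index (M : nat) (m : {ffun 'I_k -> 'I_M}) (i : nat) : nat :=
  if insub i is Some i' then m i' else 0%N.

(** Restricting the cell indices to ['I_M] truncates the gaps below [M / N.+1] and makes the union
    finite. *)
Definition grid_void (N M : nat) : set T :=
  \bigcup_(m in [set: {ffun 'I_k -> 'I_M}])
    (gap_cell N (grid_index m) `&`
     void_event (fun j _ => grid_time N (grid_index m) j)).

Lemma grid_indexE M (m : {ffun 'I_k -> 'I_M}) (i : 'I_k) :
  grid_index m i = m i.
Proof. by rewrite /grid_index valK. Qed.

Lemma measurable_grid_void N M : measurable (grid_void N M).
Proof.
apply: fin_bigcup_measurable; first exact: finite_finset.
move=> m _; apply: measurableI; first exact: measurable_gap_cell.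
by apply: measurable_void_event => j; exact: measurable_cst.
Qed.

(** The cells are disjoint; on each, independence splits the probability into a crawl factor and a
    void factor. Distributivity turns the sum over [m] of products into a product of sums. Gaps
    outside [J] get rate 0, that is, a void factor 1. *)
Lemma probability_grid_void N M :
  P (grid_void N M) = (\prod_(i < k) \sum_(m < M)
    (expR (- p * (m%:R / N.+1%:R)) - expR (- p * (m.+1%:R / N.+1%:R))) *
    expR (- ((if J i then Delta else 0) * (m.+1%:R / N.+1%:R))))%:E.
Proof.
rewrite /grid_void measure_fin_bigcup//; last 3 first.
- exact: finite_finset.
- move=> m m' _ _ [w [[mw _] [m'w _]]]; apply/ffunP => i; apply: val_inj => /=.
  have := mw i (ltn_ord i) isT; have := m'w i (ltn_ord i) isT.
  rewrite !grid_indexE => h' h.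
  have N0 : 0 < N.+1%:R :> R by [].
  (* The index of a cell is recovered as the integer part of the gap times [N.+1]. *)
  move: h h'; rewrite !ler_pdivrMr// !ltr_pdivlMr// => h h'.
  by rewrite -(truncn_def h) -(truncn_def h').
- move=> m _; apply: measurableI; first exact: measurable_gap_cell.
  by apply: measurable_void_event => j; exact: measurable_cst.
rewrite (_ : [set: {ffun 'I_k -> 'I_M}] = [set` enum {ffun 'I_k -> 'I_M}]); last first.
  by apply/seteqP; split => m //= _; rewrite mem_enum.
rewrite -fsbig_seq ?enum_uniq// big_enum/= bigA_distr_bigA/= -sumEFin.
apply: eq_bigr => m _.
rewrite setIC (page_independent page); last 2 first.
- exact: sigma_generated_void_grid_time.
- exact: sigma_generated_gap_cell.
rewrite probability_void_grid_time probability_gap_cell -EFinM; congr (_%:E).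
rewrite [X in X * _]big_mkcond -big_split/=; apply: eq_bigr => i _.
rewrite grid_indexE mulrC; congr (_ * _).
by case: ifP => // _; rewrite mul0r oppr0 expR0.
Qed.

(** Once [k / n.+1] is below the tolerance [e], rounding moves no crawl time past a change, and once
    [t k w < n.+1] the outcome lies in one of the cells. *)
Lemma near_grid_void w : (forall j, t j w < t j.+1 w) ->
  \forall n \near \oo, grid_void n (n.+1 * n.+1) w <-> void_event t w.
Proof.
move=> t_incr.
have t_nd : {homo (fun j => t j w) : i j / (i <= j)%N >-> i <= j}.
  apply: (@homo_leq _ _ (fun x y => x <= y)) => //; first exact: le_trans.
  by move=> j; exact: ltW.
have [e e0 he] := @locally_finite_perturb R (Phi w) (fun j => t j w) k
  (@poisson_support _ _ _ _ _ _ Poi w) (poisson_locally_finite Poi w).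
near=> n.
have N0 : 0 < n.+1%:R :> R by [].
have void_eq m : gap_cell n m w ->
    void_event t w <-> void_event (fun j _ => grid_time n m j) w.
  move=> mw.
  have ts j x : (j <= k)%N -> Phi w x -> (t j w < x) = (grid_time n m j < x).
    move=> jk; apply: he => //.
    have /andP[h1 h2] := gap_cell_grid_time mw jk.
    rewrite h1 (le_trans h2)// lerD2l (@le_trans _ _ (k%:R / n.+1%:R))//.
      by rewrite ler_pM2r ?invr_gt0// ler_nat.
    rewrite ler_pdivrMr// mulrC -ler_pdivrMr// ltW//.
    by near: n; exact: near_gtnS.
  have itvE j : (j < k)%N -> Phi w `&` `]t j w, t j.+1 w] =
      Phi w `&` `]grid_time n m j, grid_time n m j.+1].
    move=> jk; apply/seteqP; split=> x [Phix]; rewrite /= !in_itv/=.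
      by rewrite (ts j x (ltnW jk))// !leNgt (ts j.+1 x jk).
    by rewrite (ts j x (ltnW jk))// !leNgt (ts j.+1 x jk).
  by split => h j jk Jj; have := h j jk Jj; rewrite itvE.
split=> [[m _ [mw vw]]|vw]; first by apply/(void_eq _ mw).
(* The cell index is the integer part of [n.+1] times the gap; the gap is at most [t k w < n.+1],
   whence the bound [n.+1 * n.+1]. *)
have gM (i : 'I_k) :
    (Num.truncn (n.+1%:R * (t i.+1 w - t i w)) < n.+1 * n.+1)%N.
  rewrite truncn_lt_nat; last by rewrite mulr_ge0// subr_ge0 ltW.
  rewrite natrM ltr_pM2l//.
  have h0 : 0 <= t i w by rewrite -(crawl_start crawl w) t_nd.
  have h1 : t i.+1 w <= t k w by apply: t_nd; exact: ltn_ord.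
  apply: (@le_lt_trans _ _ (t k w)); first by rewrite lerBlDr (le_trans h1)// lerDl.
  by near: n; exact: near_gtnS.
pose m : {ffun 'I_k -> 'I_(n.+1 * n.+1)} := [ffun i => Ordinal (gM i)].
have mw : gap_cell n (grid_index m) w.
  move=> i ik _; rewrite (grid_indexE m (Ordinal ik)) ffunE/=.
  rewrite ler_pdivrMr// ltr_pdivlMr// mulrC.
  by apply: truncn_itv; rewrite mulr_ge0// subr_ge0 ltW.
by exists m => //; split=> //; exact/void_eq.
Unshelve. all: by end_near. Qed.

(** Both sides are limits of the probabilities of [grid_void]. A factor outside [J] is the case
    [D = 0] of the Laplace limit, with value 1. *)
Lemma probability_void_event :
  P (void_event t) = (\prod_(i < k) (if J i then p / (p + Delta) else 1))%:E.
Proof.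
have h1 : P (grid_void n (n.+1 * n.+1)) @[n --> \oo] --> P (void_event t).
  apply: cvg_measure_eventually_eq.
  - by move=> n; exact: measurable_grid_void.
  - by apply: measurable_void_event => j.
  - by apply: filterS (crawl_increasing crawl) => w; exact: near_grid_void.
rewrite -(cvg_lim _ h1)//; apply: cvg_lim => //.
rewrite (_ : (fun n => _) = EFin \o fun n => \prod_(i < k)
    \sum_(m < (n.+1 * n.+1)%N)
    (expR (- p * (m%:R / n.+1%:R)) - expR (- p * (m.+1%:R / n.+1%:R))) *
    expR (- ((if J i then Delta else 0) * (m.+1%:R / n.+1%:R)))); last first.
  by apply/funext => n; exact: probability_grid_void.
apply: cvg_EFin; first exact: nearW.
apply: (@cvg_big R^o) => [|i _]; first exact: mul_continuous.
have -> : (if J i then p / (p + Delta) else 1) =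
    p / (p + (if J i then Delta else 0)).
  by case: ifP => // _; rewrite addr0 divff// gt_eqF.
by apply: cvg_discretized_laplace => //; case: ifP => // _; exact: ltW.
Qed.

End void_crawl_gaps.

(** * Exponential moments of the change count *)

Section change_count_mgf.
Context {d} {T : measurableType d} {R : realType} {P : probability T R}.
Variables (Delta p : R) (Phi : T -> set R) (t : nat -> {RV P >-> R}).
Hypotheses (Delta_gt0 : 0 < Delta) (p_gt0 : 0 < p).
Hypothesis page : crawled_page Delta p Phi t.

Let Poi : poisson_process P Delta Phi := page_changes page.
Let q := Delta / (Delta + p).
Let S := change_count Phi t.

Lemma change_countE k w : S k w = \sum_(i < k) change_indicator Phi t i.+1 w.
Proof. by rewrite /S /change_count big_add1/= big_mkord. Qed.

Lemma measurable_change_indicator k :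
  measurable_fun setT (change_indicator Phi t k).
Proof.
by apply: measurable_indic; exact: (measurable_meets_random_interval Poi).
Qed.

Lemma measurable_change_count k : measurable_fun setT (S k).
Proof. by apply: measurable_sum => i; exact: measurable_change_indicator. Qed.

Lemma change_count_ge0 k w : 0 <= S k w.
Proof. by rewrite change_countE sumr_ge0. Qed.

Lemma change_count_le k w : S k w <= k%:R.
Proof.
rewrite change_countE (@le_trans _ _ (\sum_(i < k) 1))//; last first.
  by rewrite sumr_const card_ord.
by apply: ler_sum => i _; rewrite /change_indicator indicE lern1 leq_b1.
Qed.

Lemma integral_prod_change_indicator (k : nat) (a b : R) :
  (\int[P]_w (\prod_(i < k) (a + b * (1 - change_indicator Phi t i.+1 w)))%:E =
   ((a + b * (1 - q)) ^+ k)%:E)%E.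
Proof.
pose J_ (J : {set 'I_k}) (i : nat) := if insub i is Some i' then i' \in J else false.
have J_E J (i : 'I_k) : J_ J i = (i \in J) by rewrite /J_ valK.
pose c (J : {set 'I_k}) := \prod_(i < k) (if i \in J then b else a).
pose E (J : {set 'I_k}) := void_event Phi k (J_ J) t.
have mE J : measurable (E J) by apply: (measurable_void_event page) => j.
have expand w : \prod_(i < k) (a + b * (1 - change_indicator Phi t i.+1 w)) =
    \sum_(J in {set 'I_k}) c J * \1_(E J) w.
  under eq_bigr do rewrite addrC.
  rewrite bigA_distr; apply: eq_bigr => J _.
  have [EJw|EJw] := boolP (w \in E J).
    rewrite indicE EJw mulr1; apply: eq_bigr => i _; case: ifP => // iJ.
    have := set_mem EJw i (ltn_ord i); rewrite J_E iJ => /(_ isT) h.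
    rewrite /change_indicator indicE memNset/= ?subr0 ?mulr1//.
    by rewrite h => -[].
  rewrite indicE (negbTE EJw) mulr0.
  (* Outside the void event some gap of [J] contains a change, and its factor is 0. *)
  have [i iJ hi] : exists2 i : 'I_k, i \in J &
      Phi w `&` `]t i w, t i.+1 w] !=set0.
    apply: contrapT => h; move/negP : EJw; apply; apply/mem_set => j jk.
    rewrite (J_E J (Ordinal jk)) => jJ; apply/nonemptyPn => hj; apply: h.
    by exists (Ordinal jk).
  rewrite (bigD1 i)//= iJ /change_indicator indicE mem_set//.
  by rewrite subrr mulr0 mul0r.
under eq_integral do rewrite expand -sumEFin.
rewrite integral_sum//; last first.
  move=> J; under eq_fun do rewrite EFinM.
  by apply: integrableZl => //; exact: integrable_indic.
rewrite (eq_bigr (fun J => (c J *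
    \prod_(i < k) (if i \in J then p / (p + Delta) else 1))%:E)); last first.
  move=> J _; under eq_integral do rewrite EFinM.
  rewrite integralZl//; last exact: integrable_indic.
  rewrite integral_indic// setIT.
  rewrite EFinM; congr (_ * _)%E.
  apply: etrans (probability_void_event Delta_gt0 p_gt0 page k (J_ J)) _.
  by under eq_bigr do rewrite J_E.
rewrite sumEFin; congr (_%:E).
have -> : 1 - q = p / (p + Delta).
  by rewrite /q; field; rewrite gt_eqF// addr_gt0.
rewrite (addrC a) -[X in _ ^+ X](card_ord k) -prodr_const bigA_distr.
apply: eq_bigr => J _; rewrite -big_split/=; apply: eq_bigr => i _.
by case: ifP => _; rewrite ?mulr1.
Qed.

Lemma change_count_mgf_le (k : nat) (c : R) : `|c| <= 2^-1 ->
  (\int[P]_w (expR (c * (S k w - q * k%:R)))%:E <=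
   (expR (2 * c ^+ 2 * k%:R))%:E)%E.
Proof.
move=> c2.
(* Chosen so that [a + b * (1 - I)] equals [expR (c * (I - q))] for both values 0 and 1 of an
   indicator [I]. *)
pose a := expR (c * (1 - q)); pose b := expR (- (c * q)) - a.
have prodE w : expR (c * (S k w - q * k%:R)) =
    \prod_(i < k) (a + b * (1 - change_indicator Phi t i.+1 w)).
  have -> : c * (S k w - q * k%:R) =
      \sum_(i < k) c * (change_indicator Phi t i.+1 w - q).
    rewrite -mulr_sumr change_countE sumrB sumr_const card_ord.
    by rewrite mulr_natr.
  rewrite expR_sum; apply: eq_bigr => i _.
  rewrite /b /a /change_indicator indicE; case: (_ \in _) => /=.
    by rewrite subrr mulr0 addr0.
  by rewrite sub0r subr0 mulr1 addrC subrK mulrN.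
under eq_integral do rewrite prodE.
rewrite integral_prod_change_indicator lee_fin (mulrC _ k%:R) expRM_natl.
have q01 : 0 <= q <= 1.
  rewrite divr_ge0 ?addr_ge0 ?(ltW Delta_gt0) ?(ltW p_gt0)//=.
  by rewrite ler_pdivrMr ?addr_gt0// mul1r lerDl ltW.
have -> : a + b * (1 - q) = q * a + (1 - q) * expR (- (c * q)).
  by rewrite /b; ring.
rewrite lerXn2r ?nnegrE ?expR_ge0 ?bernoulli_mgf_le//.
case/andP: q01 => q0 q1.
by apply: addr_ge0; apply: mulr_ge0; rewrite ?subr_ge0//; exact: expR_ge0.
Qed.

End change_count_mgf.

(** * Error estimates *)

(** As [1 - q = 2 * eta], the condition [S - q * k <= eta * k] leaves [k - S >= eta * k] in the
    denominator. Without it, [S <= k] still makes the denominator at least [alpha], and [S - q * k]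
    is at most [k] in absolute value. *)
Lemma lln_error_bound (R : realFieldType) (Delta p S k alpha : R) :
  0 < Delta -> 0 < p -> 0 <= S <= k -> 0 < k -> 0 < alpha ->
  let q := Delta / (Delta + p) in let eta := (1 - q) / 2 in
  let err := `|p * S / (k + alpha - S) - Delta| in
  (S - q * k <= eta * k ->
     err <= (Delta + p) / eta * (`|S - q * k| / k + alpha / k)) /\
  err <= (Delta + p) * (1 + k / alpha).
Proof.
move=> D0 p0 /andP[S0 Sk] k0 a0 q eta err.
have Dp0 : 0 < Delta + p by rewrite addr_gt0.
have q0 : 0 <= q by rewrite divr_ge0 ?ltW.
have q1 : q < 1 by rewrite ltr_pdivrMr// mul1r ltrDl.
have eta0 : 0 < eta by rewrite divr_gt0// subr_gt0.
have d0 : 0 < k + alpha - S by lra.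
have errE : err = (Delta + p) * (`|S - q * k - q * alpha| / (k + alpha - S)).
  rewrite -(gtr0_norm Dp0) -[X in _ / X](gtr0_norm d0) -normf_div -normrM.
  by rewrite /err /q; congr `|_|; field; rewrite !gt_eqF.
have num_le : `|S - q * k - q * alpha| <= `|S - q * k| + alpha.
  rewrite (le_trans (ler_normB _ _))// lerD2l ger0_norm; last by rewrite mulr_ge0// ltW.
  by rewrite ler_piMl// ltW.
split=> [Sle|]; rewrite errE.
  have d1 : eta * k <= k + alpha - S by rewrite /eta in Sle *; lra.
  rewrite -mulrA ler_wpM2l ?(ltW Dp0)// -mulrDl mulrCA -invfM.
  by apply: ler_pM; rewrite ?invr_ge0 ?(ltW d0)// lef_pV2 ?posrE// mulr_gt0.
rewrite ler_wpM2l ?(ltW Dp0)// ler_pdivrMr//.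
have Ykle : `|S - q * k| <= k.
  by rewrite ler_norml; apply/andP; split; nra.
rewrite (le_trans num_le)// (@le_trans _ _ ((1 + k / alpha) * alpha))//.
  by rewrite mulrDl mul1r divfK ?gt_eqF// addrC lerD2l.
rewrite ler_wpM2l//; last by lra.
by rewrite addr_ge0 ?divr_ge0// ltW.
Qed.

Section error_estimates.
Context {d} {T : measurableType d} {R : realType} {P : probability T R}.
Variables (Delta p : R) (Phi : T -> set R) (t : nat -> {RV P >-> R}).
Hypotheses (Delta_gt0 : 0 < Delta) (p_gt0 : 0 < p).
Hypothesis page : crawled_page Delta p Phi t.

Let q := Delta / (Delta + p).
Let S := change_count Phi t.

(** A common form of the Chernoff arguments: the pair in [s] controls deviations of both signs, the
    term in [c] a tail on one side. The moment bound depends on the square of [s], hence the factor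
    2. *)
Lemma integral_le_change_count_mgf (k : nat) (f : T -> R) (a b e s c : R) :
  measurable_fun setT f -> (forall w, 0 <= f w) ->
  0 <= a -> 0 <= b -> 0 <= e -> `|s| <= 2^-1 -> `|c| <= 2^-1 ->
  (forall w, let Y := S k w - q * k%:R in
     f w <= a + b * (expR (s * Y) + expR (- (s * Y))) + e * expR (c * Y)) ->
  (\int[P]_w (f w)%:E <= (a + b * (2 * expR (2 * s ^+ 2 * k%:R)) +
     e * expR (2 * c ^+ 2 * k%:R))%:E)%E.
Proof.
move=> mf f0 a0 b0 e0 s2 c2 fle.
pose X (r : R) w := expR (r * (S k w - q * k%:R)).
have mX r : measurable_fun setT (EFin \o X r).
  apply/measurable_EFinP; apply: measurableT_comp => //.
  apply: measurable_funM => //; apply: measurable_funB => //.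
  exact: measurable_change_count page k.
have X0 r w : (0 <= (EFin \o X r) w)%E by rewrite lee_fin expR_ge0.
have scale r x : 0 <= r -> (\int[P]_w (r%:E * (EFin \o X x) w) =
    r%:E * \int[P]_w (EFin \o X x) w)%E.
  by move=> r0; rewrite ge0_integralZl_EFin.
have mscale r x : measurable_fun setT (fun w => r%:E * (EFin \o X x) w)%E.
  exact: measurable_funeM.
have scale0 r x w : 0 <= r -> (0 <= r%:E * (EFin \o X x) w)%E.
  by move=> r0; rewrite mule_ge0.
pose g w := (a%:E + b%:E * (EFin \o X s) w + b%:E * (EFin \o X (- s)%R) w +
  e%:E * (EFin \o X c) w)%E.
have mg1 : measurable_fun setT (fun w => a%:E + b%:E * (EFin \o X s) w)%E.
  exact: emeasurable_funD.
have mg2 : measurable_fun setT (fun w => a%:E + b%:E * (EFin \o X s) w +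
    b%:E * (EFin \o X (- s)%R) w)%E.
  exact: emeasurable_funD.
have mg : measurable_fun setT g by exact: emeasurable_funD.
apply: (@le_trans _ _ (\int[P]_w g w)%E).
  apply: ge0_le_integral => //.
  - by move=> w _; rewrite lee_fin.
  - exact/measurable_EFinP.
  - move=> w _; rewrite /g /X /= -!EFinM -!EFinD lee_fin.
    by rewrite -(addrA a) -mulrDr mulNr; exact: fle.
have a0' : (0 <= a%:E)%E by rewrite lee_fin.
rewrite /g ge0_integralD//; last 2 first.
  by move=> w _; rewrite !adde_ge0// scale0.
  by move=> w _; rewrite scale0.
rewrite ge0_integralD//; last 2 first.
  by move=> w _; rewrite !adde_ge0// scale0.
  by move=> w _; rewrite scale0.
rewrite ge0_integralD//; last first.
  by move=> w _; rewrite scale0.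
have cstE : (\int[P]_w a%:E)%E = a%:E by have := expectation_cst P a; rewrite unlock.
rewrite !scale// cstE.
have mgf r := @change_count_mgf_le _ _ _ _ _ _ _ _ Delta_gt0 p_gt0 page k r.
rewrite (_ : b * (2 * _) = b * expR (2 * s ^+ 2 * k%:R) +
  b * expR (2 * (- s) ^+ 2 * k%:R)); last by rewrite sqrrN; ring.
rewrite addrA !EFinD !EFinM.
have ns2 : `|- s| <= 2^-1 by rewrite normrN.
by apply: leeD; [apply: leeD; [apply: leeD|]|] => //;
  rewrite lee_wpmul2l ?lee_fin//; exact: mgf.
Qed.

Lemma measurable_lln_estimator (alpha : nat -> R) (k : nat) : 0 < alpha k ->
  measurable_fun setT (lln_estimator Phi t p alpha k).
Proof.
move=> a0.
have mS : measurable_fun setT (S k) by exact: measurable_change_count page k.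
(* The inverse becomes a real power, for which measurability is known; the two agree because the
   denominator is positive. *)
have -> : lln_estimator Phi t p alpha k =
    fun w => p * S k w * (k%:R + alpha k - S k w) `^ (-1).
  apply/funext => w; rewrite powR_inv1//.
  by have Sk : S k w <= k%:R := change_count_le Phi t k w; lra.
apply: measurable_funM; first exact: measurable_funM.
apply: (measurableT_comp (measurable_powR (-1))).
exact: measurable_funB.
Qed.

(* Chernoff is used twice: with s = k^(-1/2) to bound E|S k - q k|, and with c
   of constant order for the event that S k - q k > eta * k. *)
Lemma expectation_lln_error_le (alpha : nat -> R) (k : nat) :
  (4 <= k)%N -> 0 < alpha k ->
  let eta := (1 - q) / 2 in
  ln (k%:R / alpha k) / k%:R <= eta ^+ 2 / 16 ->
  ('E_P[fun w => (`|lln_estimator Phi t p alpha k w - Delta|)%R] <=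
   (((Delta + p) / eta * (2 * expR 2 + 1) + 32 * (Delta + p) / eta ^+ 2) *
    Num.max (k%:R `^ (- 2^-1)) (alpha k / k%:R))%:E)%E.
Proof.
move=> k4 a0 eta lnle.
have Dp0 : 0 < Delta + p by rewrite addr_gt0.
have q0 : 0 <= q by rewrite divr_ge0 ?ltW.
have q1 : q < 1 by rewrite ltr_pdivrMr// mul1r ltrDl.
have eta0 : 0 < eta by rewrite divr_gt0// subr_gt0.
have eta2 : eta <= 2^-1 by rewrite /eta; lra.
have k0 : 0 < k%:R :> R by rewrite ltr0n (leq_trans _ k4).
set K : R := k%:R in k0 lnle *.
pose s := K `^ (- 2^-1).
have s0 : 0 < s by exact: powR_gt0.
have sE : s ^+ 2 = K^-1.
  by rewrite /s -powR_mulrn ?powR_ge0// -powRrM mulNr mulVf// powR_inv1// ltW.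
(* This is where [4 <= k] enters: [s] must lie in the range of the moment bound. *)
have s2 : s <= 2^-1.
  rewrite -(@ler_pXn2r _ 2) ?nnegrE ?(ltW s0)// sE exprVn lef_pV2 ?posrE//.
  by rewrite -natrX ler_nat.
(* The minimizer of the exponent [- c * eta + 2 * c ^+ 2], with minimum [- eta ^+ 2 / 8]. *)
pose c := eta / 4.
have c2 : `|c| <= 2^-1 by rewrite gtr0_norm ?divr_gt0// /c; lra.
(* When [Y > eta * K], [expR (c * (Y - eta * K)) >= 1], so [e * expR (c * Y)] dominates the crude
   error bound. *)
pose e := (Delta + p) * (1 + K / alpha k) * expR (- (c * (eta * K))).
have Ka0 : 0 <= K / alpha k by rewrite divr_ge0 ?ltW.
have e0 : 0 <= e.
  by apply: mulr_ge0 (expR_ge0 _); apply: mulr_ge0 (ltW Dp0) _; apply: addr_ge0.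
pose D := (Delta + p) / eta.
have D0 : 0 < D by exact: divr_gt0.
have aK0 : 0 < alpha k / K by exact: divr_gt0.
rewrite unlock; apply: (@le_trans _ _ (D * (alpha k / K) +
    D * s * (2 * expR (2 * s ^+ 2 * K)) + e * expR (2 * c ^+ 2 * K))%:E).
  apply: integral_le_change_count_mgf => //.
  - apply: measurableT_comp => //; apply: measurable_funB => //.
    exact: measurable_lln_estimator.
  - by rewrite mulr_ge0 ?ltW.
  - by rewrite mulr_ge0 ?ltW.
  - by rewrite gtr0_norm.
  move=> w; cbv zeta; set Y := S k w - q * K.
  have SK : 0 <= S k w <= K by rewrite change_count_ge0 change_count_le.
  have [h1 h2] := lln_error_bound Delta_gt0 p_gt0 SK k0 a0.
  have cosh_ge0 : 0 <= D * s * (expR (s * Y) + expR (- (s * Y))).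
    by apply: mulr_ge0 (addr_ge0 (expR_ge0 _) (expR_ge0 _)); rewrite mulr_ge0 ?ltW.
  have [Yle|Ygt] := leP Y (eta * K).
    rewrite (le_trans (h1 Yle))// -/D -/Y -[leLHS]addr0.
    apply: lerD; last by rewrite mulr_ge0 ?expR_ge0.
    rewrite addrC mulrDr lerD2l -mulrA ler_wpM2l ?(ltW D0)//.
    (* Since [s ^+ 2 = K^-1], the term is [s] times the absolute value of [s * Y], which the sum of
       the two exponentials bounds. *)
    rewrite -sE expr2 mulrC -mulrA ler_wpM2l ?(ltW s0)//.
    rewrite -(ger0_norm (ltW s0)) -normrM (ger0_norm (ltW s0)).
    have := expR_ge1Dx (s * Y); have := expR_ge1Dx (- (s * Y)).
    have := expR_ge0 (s * Y); have := expR_ge0 (- (s * Y)).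
    by rewrite ler_norml => ? ? ? ?; apply/andP; split; lra.
  rewrite (le_trans h2)// -[leLHS]add0r; apply: lerD.
    by rewrite addr_ge0// mulr_ge0 ?ltW.
  rewrite /e -mulrA -expRD ler_peMr//; first exact: mulr_ge0 (ltW Dp0) (addr_ge0 ler01 Ka0).
  rewrite -expR0 ler_expR addrC subr_ge0 ler_wpM2l ?(ltW Ygt)//.
  by rewrite divr_ge0 ?ltW.
rewrite lee_fin -/s; set M := Num.max _ _.
have sM : s <= M by rewrite le_max lexx.
have aM : alpha k / K <= M by rewrite le_max lexx orbT.
have -> : 2 * s ^+ 2 * K = 2 by rewrite sE mulfVK ?gt_eqF.
have tail : e * expR (2 * c ^+ 2 * K) <= 32 * (Delta + p) / eta ^+ 2 * s.
  have KaE : K / alpha k <= expR (eta ^+ 2 * K / 16).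
    have Ka1 : 0 < K / alpha k by rewrite divr_gt0.
    by rewrite -[leLHS](lnK Ka1) ler_expR mulrAC -ler_pdivrMr.
  (* The exponential gain is 2x, of which k / alpha_k can use up only x. *)
  pose x := eta ^+ 2 * K / 16.
  have x0 : 0 < x by rewrite divr_gt0// mulr_gt0// exprn_gt0.
  have E1 : 1 <= expR x by rewrite -expR0 ler_expR ltW.
  rewrite /e -mulrA -expRD.
  have -> : - (c * (eta * K)) + 2 * c ^+ 2 * K = - (2 * x).
    by rewrite /c /x; field.
  apply: (@le_trans _ _ ((Delta + p) * (2 * expR x) * expR (- (2 * x)))).
    rewrite ler_wpM2r ?expR_ge0// ler_wpM2l ?(ltW Dp0)//.
    by rewrite -/x in KaE; lra.
  rewrite -!mulrA -expRD (_ : x + - (2 * x) = - x); last by ring.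
  (* The inequality [expR (- x) <= x^-1] suffices: [x^-1] is a multiple of [s ^+ 2], and
     [s <= 1]. *)
  have ex : expR (- x) <= 16 / eta ^+ 2 * s.
    apply: (@le_trans _ _ x^-1).
      rewrite expRN lef_pV2 ?posrE ?expR_gt0//.
      by rewrite (le_trans _ (expR_ge1Dx x))// lerDr.
    have -> : x^-1 = 16 / eta ^+ 2 * s ^+ 2.
      by rewrite sE /x; field; rewrite !gt_eqF.
    rewrite ler_wpM2l ?divr_ge0 ?sqr_ge0// expr2 ler_piMl ?(ltW s0)//.
    by rewrite (le_trans s2)// invf_le1// ler1n.
  have -> : 32 * ((Delta + p) * ((eta ^+ 2)^-1 * s)) =
      (Delta + p) * (2 * (16 / eta ^+ 2 * s)) by ring.
  by rewrite !ler_wpM2l// ltW.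
have h1 : D * (alpha k / K) <= D * M by rewrite ler_wpM2l ?(ltW D0).
have h2 : D * s * (2 * expR 2) <= D * M * (2 * expR 2).
  by rewrite ler_wpM2r ?mulr_ge0 ?expR_ge0// ler_wpM2l ?(ltW D0).
have h3 : 32 * (Delta + p) / eta ^+ 2 * s <= 32 * (Delta + p) / eta ^+ 2 * M.
  rewrite ler_wpM2l// divr_ge0 ?sqr_ge0// mulr_ge0//; exact: ltW.
apply: le_trans (lerD (lerD h1 h2) (le_trans tail h3)) _.
by rewrite le_eqVlt; apply/orP; left; apply/eqP; rewrite -/D; ring.
Qed.

(** Two-sided Chernoff bound with the optimal [c = eps / 4], in the range of the moment bound as
    [eps <= 1]. The power form makes the bounds a geometric series in [k]. *)
Lemma deviation_probability_le (k : nat) (eps : R) : 0 < eps -> eps <= 1 ->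
  (P [set w | (eps * k%:R <= `|S k w - q * k%:R|)%R] <=
   (2 * expR (- (eps ^+ 2 / 8)) ^+ k)%:E)%E.
Proof.
move=> eps0 eps1; set F := (X in P X).
have mS : measurable_fun setT (S k) by exact: measurable_change_count page k.
have mF : measurable F.
  rewrite -[X in measurable X]setTI; apply: measurable_fun_ler => //.
  by apply: measurableT_comp => //; exact: measurable_funB.
pose c := eps / 4.
have c2 : `|c| <= 2^-1 by rewrite gtr0_norm ?divr_gt0// /c; lra.
pose b := expR (- (c * (eps * k%:R))).
have h0 : `|0 : R| <= 2^-1 by rewrite normr0.
have := @integral_le_change_count_mgf k \1_F 0 b 0 c 0 _ _ (lexx _)
  (expR_ge0 _) (lexx _) c2 h0.
rewrite integral_indic// setIT; move=> /(_ _ _ _)/le_trans; apply => //.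
  move=> w; cbv zeta; set Y := S k w - q * k%:R.
  rewrite add0r mul0r addr0 indicE mulrDr /b -!expRD.
  have [/set_mem|_] := boolP (w \in F); last by rewrite addr_ge0// expR_ge0.
  rewrite /F/= -/Y => Yge.
  have c0 : 0 <= c by rewrite divr_ge0// ltW.
  have [Y0|Y0] := leP 0 Y.
    rewrite ger0_norm// in Yge.
    rewrite -[leLHS]addr0 lerD ?expR_ge0// -[leLHS]expR0 ler_expR.
    by rewrite addrC subr_ge0 ler_wpM2l.
  rewrite ltr0_norm// in Yge.
  rewrite -[leLHS]add0r lerD ?expR_ge0// -[leLHS]expR0 ler_expR.
  by rewrite addrC subr_ge0 -mulrN ler_wpM2l.
rewrite mul0r addr0 add0r lee_fin mulrCA ler_wpM2l// /b -expRD -expRM_natl.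
by rewrite ler_expR le_eqVlt; apply/orP; left; apply/eqP; rewrite /c; field.
Qed.

End error_estimates.

(** * Almost sure convergence and conclusion *)

(** For each tolerance [1 / i.+1] the deviation probabilities are summable, so Borel-Cantelli
    applies; countably many tolerances suffice. *)
Lemma change_count_slln {d} {T : measurableType d} {R : realType}
    {P : probability T R} (Delta p : R) (Phi : T -> set R)
    (t : nat -> {RV P >-> R}) :
  0 < Delta -> 0 < p -> crawled_page Delta p Phi t ->
  {ae P, forall w,
    change_count Phi t k w / k%:R @[k --> \oo] --> Delta / (Delta + p)}.
Proof.
move=> Delta_gt0 p_gt0 page; pose q := Delta / (Delta + p).
pose S := change_count Phi t.
pose F (i k : nat) := [set w | i.+1%:R^-1 * k%:R <= `|S k w - q * k%:R|].
have mF i k : measurable (F i k).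
  have mS : measurable_fun setT (S k) by exact: measurable_change_count page k.
  rewrite -[X in measurable X]setTI; apply: measurable_fun_ler => //.
  by apply: measurableT_comp => //; exact: measurable_funB.
have F0 i : P (lim_sup_set (F i)) = 0%E.
  apply: lim_sup_set_cvg0 => //.
  pose x : R := expR (- (i.+1%:R^-1 ^+ 2 / 8)).
  have x1 : x < 1.
    by rewrite /x -[ltRHS]expR0 ltr_expR oppr_lt0 divr_gt0// exprn_gt0// invr_gt0.
  apply: (@le_lt_trans _ _ (2 / (1 - x))%:E); last exact: ltry.
  apply: lime_le; first by apply: is_cvg_nneseries.
  apply: nearW => n; rewrite big_mkord.
  apply: (@le_trans _ _ (\sum_(k < n) (2 * x ^+ k)%:E)%E).
    apply: lee_sum => k _; apply: (deviation_probability_le Delta_gt0 p_gt0 page).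
      by rewrite invr_gt0.
    by rewrite invf_le1// ler1n.
  rewrite sumEFin lee_fin -mulr_sumr ler_wpM2l// sum_geometric ?lt_eqF//.
  rewrite ler_piMl ?invr_ge0 ?subr_ge0 ?(ltW x1)//.
  by rewrite gerBl exprn_ge0// expR_ge0.
have : {ae P, forall w, forall i, \forall k \near \oo, ~ F i k w}.
  apply: ae_foralln => i; exists (lim_sup_set (F i)); split; last 2 first.
  - exact: F0.
  - move=> w /= hw n _; apply: contrapT => h; apply: hw.
    by exists n => // k /= nk Fk; apply: h; exists k.
  by apply: bigcap_measurable => // n _; exact: bigcup_measurable.
apply: filterS => w hw; apply/cvgrPdist_lt => e e0.
have [i ie] : exists i : nat, i.+1%:R^-1 < e.
  have [N _ /(_ _ (leqnn _)) /=] := near_gtnS e^-1.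
  by exists N; rewrite invf_plt ?posrE.
near=> k; have k0 : 0 < k%:R :> R by rewrite ltr0n; near: k; exact: nbhs_infty_gt.
have : ~ F i k w by near: k; exact: hw.
rewrite /F/= => /negP; rewrite -ltNge => h; apply: lt_trans ie.
rewrite distrC -[X in _ - X](mulfK (lt0r_neq0 k0)) -mulrBl normrM normfV.
by rewrite (gtr0_norm k0) ltr_pdivrMr.
Unshelve. all: by end_near. Qed.

(** Deterministic, to be applied path by path: divide through by [k] and use
    [p * q / (1 - q) = Delta] for [q = Delta / (Delta + p)]. *)
Lemma lln_estimator_cvg (R : realType) (Delta p : R) (S alpha : nat -> R) :
  0 < Delta -> 0 < p ->
  S k / k%:R @[k --> \oo] --> Delta / (Delta + p) ->
  alpha k / k%:R @[k --> \oo] --> 0 ->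
  p * S k / (k%:R + alpha k - S k) @[k --> \oo] --> Delta.
Proof.
move=> Delta0 p0 cS ca; have Dp0 : 0 < Delta + p by rewrite addr_gt0.
have -> : Delta = p * (Delta / (Delta + p)) / (1 + 0 - Delta / (Delta + p)).
  by field; rewrite !gt_eqF//; lra.
have h : p * (S k / k%:R) / (1 + alpha k / k%:R - S k / k%:R) @[k --> \oo] -->
    p * (Delta / (Delta + p)) / (1 + 0 - Delta / (Delta + p)).
  apply: (@cvgM R).
    by apply: (@cvgM R); first exact: cvg_cst.
  apply: cvgV; last first.
    by apply: (@cvgB _ R) => //; apply: (@cvgD _ R) => //; exact: cvg_cst.
  rewrite addr0 subr_eq0 gt_eqF// ltr_pdivrMr// mul1r ltrDl//.
apply: cvg_trans h; apply: near_eq_cvg; near=> k.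
have k0 : k%:R != 0 :> R by rewrite pnatr_eq0 -lt0n; near: k; exact: nbhs_infty_gt.
have -> : 1 + alpha k / k%:R - S k / k%:R = (k%:R + alpha k - S k) / k%:R.
  by field.
by rewrite invfM invrK; move: ((_ - S k)^-1) => d; field.
Unshelve. all: by end_near. Qed.

Theorem theorem1 (R : realType) (Delta p : R) (alpha : nat -> R)
    (Delta_gt0 : 0 < Delta) (p_gt0 : 0 < p)
    (alpha_gt0 : forall k, (1 <= k)%N -> 0 < alpha k) :
  (alpha k / k%:R @[k --> \oo] --> 0 ->
   forall (d : measure_display) (T : measurableType d) (P : probability T R)
     (Phi : T -> set R) (t : nat -> {RV P >-> R}),
   crawled_page Delta p Phi t ->
   {ae P, forall w, lln_estimator Phi t p alpha k w @[k --> \oo] --> Delta})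
  /\
  (alpha k / k%:R @[k --> \oo] --> 0 ->
   ln (k%:R / alpha k) / k%:R @[k --> \oo] --> 0 ->
   exists C : R, \forall k \near \oo,
   forall (d : measure_display) (T : measurableType d) (P : probability T R)
     (Phi : T -> set R) (t : nat -> {RV P >-> R}),
   crawled_page Delta p Phi t ->
   ('E_P[fun w => (`|lln_estimator Phi t p alpha k w - Delta|)%R]
    <= (C * Num.max (k%:R `^ (- 2^-1)) (alpha k / k%:R))%:E)%E).
Proof.
split=> [ca d T P Phi t page|_ cln].
  apply: filterS (change_count_slln Delta_gt0 p_gt0 page) => w cS.
  exact: lln_estimator_cvg.
pose eta := (1 - Delta / (Delta + p)) / 2.
(* The logarithmic hypothesis is used only to get below this positive threshold eventually. *)
have eta0 : 0 < eta ^+ 2 / 16.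
  rewrite divr_gt0// exprn_gt0// divr_gt0// subr_gt0.
  by rewrite ltr_pdivrMr ?addr_gt0// mul1r ltrDl.
(* The constant depends on [Delta] and [p] alone; [alpha] only affects how large [k] must be. *)
exists ((Delta + p) / eta * (2 * expR 2 + 1) + 32 * (Delta + p) / eta ^+ 2).
near=> k => d T P Phi t page.
apply: expectation_lln_error_le => //.
- by near: k; exact: nbhs_infty_ge.
- by apply: alpha_gt0; near: k; exact: nbhs_infty_ge.
- rewrite (le_trans (ler_norm _))// ltW//.
  rewrite -normrN -[- _]sub0r; near: k.
  by move/cvgrPdist_lt: cln; apply.
Unshelve. all: by end_near. Qed.
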